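(* Let $F\subset\mathbb{R}^2$ be a non-cyclic bounded convex quadrilateral. Then there exist $S\subset T\subset\mathbb{R}^2$, with $|S|=2$ and $|T|=4$, such that $V_T(S)=F$.
   Context: For a finite nonempty set $T\subset\mathbb{R}^n$ and a nonempty proper subset $S\subset T$, the multipoint (higher order) Voronoi cell is $$V_T(S):=\left\{x\in\mathbb{R}^n : \max_{s\in S}\|x-s\|\le\min_{t\in T\setminus S}\|x-t\|\right\},$$ where $\|\cdot\|$ is the Euclidean norm. A bounded convex quadrilateral is understood as a closed region: the convex hull of four points in the plane, each of which is an extreme point of that hull (so it has exactly four vertices). It is cyclic if its four vertices lie on a single circle, and non-cyclic otherwise. *)

(* Defs.v *)
From mathcomp Require Import all_boot all_order all_algebra finmap.
From mathcomp Require Import all_classical all_reals all_analysis.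

Set Implicit Arguments.
Unset Strict Implicit.
Unset Printing Implicit Defensive.

Import Order.TTheory GRing.Theory Num.Theory.

Local Open Scope classical_set_scope.
Local Open Scope ring_scope.
Local Open Scope convex_scope.

(* The norm that MathComp-Analysis puts on ['rV[R]_n] is the sup norm, hence
   the explicit definition. *)
Definition euclidean_norm (R : realType) (n : nat) (x : 'rV[R]_n) : R :=
  Num.sqrt (\sum_(i < n) x 0 i ^+ 2).

(* The maximum and minimum are taken in [\bar R] so that the iterated operators
   have neutral elements; for nonempty index sets these play no role. *)
Definition voronoi_cell (R : realType) (n : nat) (T S : {fset 'rV[R]_n}) :
    set 'rV[R]_n :=
  [set x | (\big[maxe/-oo]_(s <- S) (euclidean_norm (x - s))%:E <=
            \big[mine/+oo]_(t <- (T `\` S)%fset) (euclidean_norm (x - t))%:E)%E].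

Definition convex_hull (R : realType) (n : nat) (A : set 'rV[R]_n) :
    set 'rV[R]_n :=
  smallest (@convex_set R 'rV[R]_n) A.

Definition extreme_points (R : realType) (n : nat) (F : set 'rV[R]_n) :
    set 'rV[R]_n :=
  [set x | F x /\
    forall (y z : convex_lmodType 'rV[R]_n) (t : {i01 R}),
      F y -> F z -> 0 < t%:num -> t%:num < 1 -> x = y <| t |> z -> y = z].

Definition convex_quadrilateral (R : realType) (F : set 'rV[R]_2) : Prop :=
  exists A : {fset 'rV[R]_2},
    [/\ #|` A| = 4%N, F = convex_hull [set` A] &
        [set` A] `<=` extreme_points F].

Definition circle (R : realType) (c : 'rV[R]_2) (r : R) : set 'rV[R]_2 :=
  [set x | euclidean_norm (x - c) = r].

(* The vertices of a convex polygon are its extreme points. *)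
Definition cyclic_polygon (R : realType) (F : set 'rV[R]_2) : Prop :=
  exists (c : 'rV[R]_2) (r : R), 0 < r /\ extreme_points F `<=` circle c r.

(* Main.v *)
(* Let the diagonals of F cross at P, so that its vertices are P + u, P - c u,
   P + v and P - d v with c, d > 0.  At x = P + xi u + eta v the functions
     1 - xi - eta,  1 + xi / c - eta,  1 + xi / c + eta / d,  1 - xi + eta / d
   vanish on consecutive edges and are nonnegative on F, and their alternating
   sum is 0.  This is the compatibility condition for them to be, up to a common
   factor k, the differences |x - t_j|^2 - |x - s_i|^2 for four points s1, s2,
   t1, t2.  Comparing coefficients leaves a linear system in s1 and 1 / k, which
   is solvable iff c |u|^2 <> d |v|^2, that is (intersecting chords) iff F is not
   cyclic.  The sign of k is that of d |v|^2 - c |u|^2, and it can be made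
   positive by exchanging the two diagonals. *)
Require Import Defs.
From mathcomp Require Import all_boot all_order all_algebra finmap.
From mathcomp Require Import all_classical all_reals all_analysis.
From mathcomp Require Import ring lra.

Set Implicit Arguments.
Unset Strict Implicit.
Unset Printing Implicit Defensive.

Import Order.TTheory GRing.Theory Num.Theory.

Local Open Scope classical_set_scope.
Local Open Scope ring_scope.

(** * Convex combinations, extreme points and hulls *)

Lemma convex_setE (R : realType) (n : nat) (A : set 'rV[R]_n) :
  convex_set A <-> forall (x y : 'rV[R]_n) (t : R), 0 <= t -> t <= 1 ->
    A x -> A y -> A (t *: x + (1 - t) *: y).
Proof.
split=> [cA x y t t0 t1 Ax Ay|cA x y t].
  by have := cA x y (Itv01 t0 t1); rewrite !inE; apply.
by rewrite !inE => Ax Ay; apply: (cA x y t%:num).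
Qed.

Lemma convex_set_comb3 (R : realType) (n : nat) (A : set 'rV[R]_n)
    (x y z : 'rV[R]_n) (a b c : R) :
  convex_set A -> A x -> A y -> A z -> 0 <= a -> 0 <= b -> 0 <= c ->
  a + b + c = 1 -> A (a *: x + b *: y + c *: z).
Proof.
move=> /convex_setE cA Ax Ay Az a0 b0 c0 abc1.
have [ab0|ab0] := eqVneq (a + b) 0.
  have -> : a = 0 by lra.
  have -> : b = 0 by lra.
  have -> : c = 1 by lra.
  by rewrite !scale0r !add0r scale1r.
have Aw : A ((a / (a + b)) *: x + (1 - a / (a + b)) *: y).
  apply: cA => //; first by rewrite divr_ge0// addr_ge0.
  by rewrite ler_pdivrMr; lra.
have -> : a *: x + b *: y + c *: z =
    (a + b) *: ((a / (a + b)) *: x + (1 - a / (a + b)) *: y)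
    + (1 - (a + b)) *: z.
  rewrite scalerDr !scalerA; congr (_ *: _ + _ *: _ + _ *: _); [field|field|lra].
    exact: ab0.
  exact: ab0.
by apply: cA => //; lra.
Qed.

Lemma extreme_point_conv (R : realType) (n : nat) (F : set 'rV[R]_n)
    (x y z : 'rV[R]_n) (t : R) :
  extreme_points F x -> F y -> F z -> 0 <= t -> t <= 1 ->
  x = t *: y + (1 - t) *: z -> x = y \/ x = z.
Proof.
move=> [Fx ex] Fy Fz t0 t1 xE.
have [tE0|tn0] := eqVneq t 0.
  by right; rewrite xE tE0 scale0r add0r subr0 scale1r.
have [tE1|tn1] := eqVneq t 1.
  by left; rewrite xE tE1 scale1r subrr scale0r addr0.
left; rewrite xE -(ex y z (Itv01 t0 t1) Fy Fz) => [|||//].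
- by rewrite -scalerDl addrC subrK scale1r.
- by rewrite /= lt_neqAle eq_sym tn0.
- by rewrite /= lt_neqAle tn1.
Qed.

(** The weights are left unnormalised so that the lemma applies directly to an affine dependence
    whose negative terms have been moved across. Grouping the first two points reduces it to two
    uses of [extreme_point_conv]. *)
Lemma extreme_point_comb3 (R : realType) (n : nat) (F : set 'rV[R]_n)
    (p x y z : 'rV[R]_n) (a b c : R) :
  convex_set F -> extreme_points F p -> F x -> F y -> F z ->
  0 <= a -> 0 <= b -> 0 <= c -> 0 < a + b + c ->
  (a + b + c) *: p = a *: x + b *: y + c *: z -> [\/ p = x, p = y | p = z].
Proof.
move=> /convex_setE cF ep Fx Fy Fz a0 b0 c0 s0 pE.
have [ab0|ab0] := eqVneq (a + b) 0.
  have a_0 : a = 0 by lra.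
  have b_0 : b = 0 by lra.
  apply: Or33; move: pE; rewrite a_0 b_0 !scale0r !add0r => /scalerI -> //.
  by rewrite gt_eqF//; lra.
have s_neq0 : a + b + c != 0 by rewrite gt_eqF.
have wl : 0 <= a / (a + b) by rewrite divr_ge0// addr_ge0.
have wr : a / (a + b) <= 1 by rewrite ler_pdivrMr; lra.
have Fw := cF _ _ _ wl wr Fx Fy.
have tl : 0 <= (a + b) / (a + b + c) by rewrite divr_ge0//; lra.
have tr : (a + b) / (a + b + c) <= 1 by rewrite ler_pdivrMr; lra.
case: (extreme_point_conv ep Fw Fz tl tr) => [|pw|->]; last exact: Or33.
  apply: (scalerI s_neq0); rewrite pE !scalerDr !scalerA.
  by congr (_ *: _ + _ *: _ + _ *: _); field; rewrite ?ab0 ?s_neq0.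
by case: (extreme_point_conv ep Fx Fy wl wr pw) => ->; [exact: Or31|exact: Or32].
Qed.

Lemma convex_hull_convex (R : realType) (n : nat) (A : set 'rV[R]_n) :
  convex_set (convex_hull A).
Proof.
apply/convex_setE => x y t t0 t1 Hx Hy B [cB AB].
by move/convex_setE: (cB); apply => //; [apply: Hx|apply: Hy].
Qed.

(** Deleting an extreme point from a convex set leaves it convex. If the point were outside [A], the
    hull without it would still contain [A], against minimality. *)
Lemma extreme_points_hull (R : realType) (n : nat) (A : set 'rV[R]_n) :
  extreme_points (convex_hull A) `<=` A.
Proof.
move=> x ex; apply: contrapT => Anx.
suff : (convex_hull A `\ x) x by case=> _; apply.
case: (ex) => + _; apply: smallest_sub; last first.
  by move=> y Ay; split; [exact: sub_gen_smallest|move=> yx; apply: Anx; rewrite -yx].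
apply/convex_setE => y z t t0 t1 [Hy nyx] [Hz nzx]; split.
  by move/convex_setE: (@convex_hull_convex R n A); apply.
move=> /esym /(extreme_point_conv ex Hy Hz t0 t1) [xy|xz].
  exact: nyx.
exact: nzx.
Qed.

(** * Voronoi cells through squared distances *)

Lemma bigmaxe_leP (R : realType) (I : eqType) (s : seq I) (f : I -> R)
    (y : \bar R) :
  reflect {in s, forall i, ((f i)%:E <= y)%E}
    (\big[maxe/-oo]_(i <- s) (f i)%:E <= y)%E.
Proof.
apply: (iffP idP) => [|H].
  elim: s => [//|a s IH]; rewrite big_cons ge_max => /andP[ay /IH {}IH] i.
  by rewrite in_cons => /orP[/eqP -> //|/IH].
elim: s H => [_|a s IH H]; first by rewrite big_nil leNye.
rewrite big_cons ge_max H ?mem_head//= IH// => i si; apply: H.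
by rewrite in_cons si orbT.
Qed.

Lemma bigmine_geP (R : realType) (I : eqType) (s : seq I) (f : I -> R)
    (y : \bar R) :
  reflect {in s, forall i, (y <= (f i)%:E)%E}
    (y <= \big[mine/+oo]_(i <- s) (f i)%:E)%E.
Proof.
apply: (iffP idP) => [|H].
  elim: s => [//|a s IH]; rewrite big_cons le_min => /andP[ay /IH {}IH] i.
  by rewrite in_cons => /orP[/eqP -> //|/IH].
elim: s H => [_|a s IH H]; first by rewrite big_nil leey.
rewrite big_cons le_min H ?mem_head//= IH// => i si; apply: H.
by rewrite in_cons si orbT.
Qed.

Lemma voronoi_cellE (R : realType) (n : nat) (T S : {fset 'rV[R]_n})
    (x : 'rV[R]_n) :
  voronoi_cell T S x <->
  forall s t, s \in S -> t \in T -> t \notin S ->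
    \sum_(i < n) (x - s) 0 i ^+ 2 <= \sum_(i < n) (x - t) 0 i ^+ 2.
Proof.
have sumge0 y : 0 <= \sum_(i < n) (x - y) 0 i ^+ 2.
  by apply: sumr_ge0 => i _; exact: sqr_ge0.
split=> [/bigmaxe_leP H s t sS tT tS|H].
  have /bigmine_geP/(_ t) := H _ sS.
  by rewrite in_fsetD tT tS lee_fin ler_sqrt//; apply.
apply/bigmaxe_leP => s sS; apply/bigmine_geP => t.
by rewrite in_fsetD lee_fin ler_sqrt// => /andP[tS tT]; exact: H.
Qed.

Lemma sqdist2E (R : realType) (x y : 'rV[R]_2) :
  \sum_(i < 2) (x - y) 0 i ^+ 2 =
  (x 0 0 - y 0 0) ^+ 2 + (x 0 1 - y 0 1) ^+ 2.
Proof.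
by rewrite !big_ord_recl big_ord0 addr0 !mxE; congr (_ + (x 0 _ - y 0 _) ^+ 2);
  exact: val_inj.
Qed.

Lemma row2P (R : realType) (x y : 'rV[R]_2) :
  x 0 0 = y 0 0 -> x 0 1 = y 0 1 -> x = y.
Proof.
move=> h0 h1; apply/rowP => i.
case: i => -[|[|//]] hi.
  by rewrite (_ : Ordinal hi = 0)//; exact: val_inj.
by rewrite (_ : Ordinal hi = 1)//; exact: val_inj.
Qed.

(** * Quadrilaterals and sites in coordinates along the diagonals *)

Definition cross (R : realType) (u v : 'rV[R]_2) : R :=
  u 0 0 * v 0 1 - u 0 1 * v 0 0.

Definition sqnorm2 (R : realType) (u : 'rV[R]_2) : R := u 0 0 ^+ 2 + u 0 1 ^+ 2.

Definition diag_vertices (R : realType) (P u v : 'rV[R]_2) (c d : R) :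
    set 'rV[R]_2 :=
  [set P + u; P - c *: u] `|` [set P + v; P - d *: v].

(** One inequality per edge, cleared of denominators. *)
Definition diag_quad (R : realType) (P u v : 'rV[R]_2) (c d : R) :
    set 'rV[R]_2 :=
  [set x | exists xi eta : R, x = P + xi *: u + eta *: v /\
    [/\ xi + eta <= 1, c * eta <= c + xi, d * xi <= d + eta &
        0 <= c * d + d * xi + c * eta]].

Lemma convex_hull_diag (R : realType) (P u v : 'rV[R]_2) (c d : R) :
  0 < c -> 0 < d ->
  convex_hull (diag_vertices P u v c d) = diag_quad P u v c d.
Proof.
move=> c0 d0; apply/seteqP; split.
  apply: smallest_sub.
    apply/convex_setE => x y t t0 t1.
    move=> [a [b [-> [h1 h2 h3 h4]]]] [a' [b' [-> [k1 k2 k3 k4]]]].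
    exists (t * a + (1 - t) * a'), (t * b + (1 - t) * b'); split.
      by apply/rowP => i; rewrite !mxE; ring.
    have t1' : 0 <= 1 - t by lra.
    by split; [have := mulr_ge0 t0 (_ : 0 <= 1 - a - b);
               have := mulr_ge0 t1' (_ : 0 <= 1 - a' - b')
              |have := mulr_ge0 t0 (_ : 0 <= c + a - c * b);
               have := mulr_ge0 t1' (_ : 0 <= c + a' - c * b')
              |have := mulr_ge0 t0 (_ : 0 <= d + b - d * a);
               have := mulr_ge0 t1' (_ : 0 <= d + b' - d * a')
              |have := mulr_ge0 t0 h4; have := mulr_ge0 t1' k4] => *; nra.
  have cd0 : 0 < c * d by exact: mulr_gt0.
  move=> x [[->|->]|[->|->]].
  - by exists 1, 0; split; [rewrite scale1r scale0r addr0|split; nra].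
  - by exists (- c), 0; split; [rewrite scaleNr scale0r addr0|split; nra].
  - by exists 0, 1; split; [rewrite scale1r scale0r addr0|split; nra].
  - by exists 0, (- d); split; [rewrite scaleNr scale0r addr0|split; nra].
have cH := @convex_hull_convex R 2 (diag_vertices P u v c d).
have HA : diag_vertices P u v c d `<=` convex_hull (diag_vertices P u v c d).
  exact: sub_gen_smallest.
set H := convex_hull _ in cH HA *.
have Hu : H (P + u) by apply: HA; left; left.
have Hcu : H (P - c *: u) by apply: HA; left; right.
have Hv : H (P + v) by apply: HA; right; left.
have Hdv : H (P - d *: v) by apply: HA; right; right.
have cn0 : c != 0 by rewrite gt_eqF.
have dn0 : d != 0 by rewrite gt_eqF.
have c1n0 : 1 + c != 0 by rewrite gt_eqF//; lra.
(* The weights [c / (1 + c)] and [1 / (1 + c)] on [P + u] and [P - c *: u] cancel the [u] terms. *)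
have HP : H P.
  have cl : 0 <= c / (1 + c) by rewrite divr_ge0//; lra.
  have cr : c / (1 + c) <= 1 by rewrite ler_pdivrMr; lra.
  have /convex_setE/(_ _ _ _ cl cr Hu Hcu) := cH.
  congr H.
  by apply/rowP => i; rewrite !mxE; field.
move=> x [a [b [-> [h1 h2 h3 h4]]]].
have comb y z (r s : R) : H y -> H z -> 0 <= r -> 0 <= s -> r + s <= 1 ->
    H (r *: y + s *: z + (1 - r - s) *: P).
  by move=> Hy Hz r0 s0 rs1; apply: convex_set_comb3 => //; lra.
(* The diagonals cut the quadrilateral into four triangles with apex [P]. The signs of [a] and [b]
   select the triangle, and the inequality of its outer edge bounds the sum of the two vertex
   weights by 1. *)
have [a0|a0] := leP 0 a; have [b0|b0] := leP 0 b.
- have := comb _ _ _ _ Hu Hv a0 b0 h1.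
  by congr H; apply/rowP => i; rewrite !mxE; ring.
- have b0' : 0 <= - b / d by rewrite divr_ge0//; lra.
  have ab1 : a + - b / d <= 1 by rewrite -lerBrDl ler_pdivrMr//; lra.
  have := comb _ _ _ _ Hu Hdv a0 b0' ab1.
  by congr H; apply/rowP => i; rewrite !mxE; field.
- have a0' : 0 <= - a / c by rewrite divr_ge0//; lra.
  have ab1 : - a / c + b <= 1 by rewrite -lerBrDr ler_pdivrMr//; lra.
  have := comb _ _ _ _ Hcu Hv a0' b0 ab1.
  by congr H; apply/rowP => i; rewrite !mxE; field.
- have a0' : 0 <= - a / c by rewrite divr_ge0//; lra.
  have b0' : 0 <= - b / d by rewrite divr_ge0//; lra.
  have ab1 : - a / c + - b / d <= 1.
    rewrite (_ : _ + _ = - (d * a + c * b) / (c * d)).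
      by rewrite ler_pdivrMr ?mulr_gt0//; lra.
    by field; rewrite ?cn0 ?dn0.
  have := comb _ _ _ _ Hcu Hdv a0' b0' ab1.
  by congr H; apply/rowP => i; rewrite !mxE; field; rewrite ?cn0 ?dn0.
Qed.

Lemma diag_verticesC (R : realType) (P u v : 'rV[R]_2) (c d : R) :
  diag_vertices P u v c d = diag_vertices P v u d c.
Proof. by rewrite /diag_vertices setUC. Qed.

(** Cramer's rule in the basis [(u, v)]. *)
Lemma cross_coord (R : realType) (P u v x : 'rV[R]_2) : cross u v != 0 ->
  x = P + (cross (x - P) v / cross u v) *: u + (cross u (x - P) / cross u v) *: v.
Proof.
by rewrite /cross => D0; apply: row2P; rewrite !mxE; field.
Qed.

(* With s1 = P + e1 u + e2 v, (e1, e2) and k solve the linear system mentioned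
   above; t1, t2 are the reflections of s1 in two edges, and s2 that of t2 in a
   third.  Here e and f are cross u v times the basis dual to (u, v). *)
Lemma sqdist_edges (R : realType) (P u v : 'rV[R]_2) (c d : R) :
  let N := d * sqnorm2 v - c * sqnorm2 u in
  let D := cross u v in
  N != 0 ->
  exists s1 s2 t1 t2 : 'rV[R]_2, forall xi eta : R,
  let x := P + xi *: u + eta *: v in
  let q y := \sum_(i < 2) (x - y) 0 i ^+ 2 in
  let k := 4 * D ^+ 2 / N in
  [/\ q t1 - q s1 = k * (c * d) * (1 - xi - eta),
      q t2 - q s1 = k * d * (c + xi - c * eta),
      q t2 - q s2 = k * (c * d + d * xi + c * eta) &
      q t1 - q s2 = k * c * (d + eta - d * xi)].
Proof.
move=> N D N0.
pose e : 'rV[R]_2 := \row_i if i == 0 then v 0 1 else - v 0 0.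
pose f : 'rV[R]_2 := \row_i if i == 0 then - u 0 1 else u 0 0.
pose uv := u 0 0 * v 0 0 + u 0 1 * v 0 1.
pose s := P + ((d * (1 - c) * sqnorm2 v + 2 * c * d * uv) / N) *: u
            - (c * (1 + d) * sqnorm2 u / N) *: v.
(* The coefficients of [xi] and [eta] prescribe the inner products of the differences of sites with
   [u] and [v], hence the differences themselves in terms of [e] and [f]. *)
exists s, (s + (2 * D / N * (c * (d + 1))) *: f),
  (s + (2 * D / N * (c * d)) *: (e + f)),
  (s - (2 * D / N * d) *: (e - c *: f)).
move=> xi eta x q k.
by split; rewrite /q !sqdist2E !mxE /= /k /D /cross;
  rewrite /uv /N /sqnorm2 in N0 *; field.
Qed.

(** The four disequalities ensure that removing [s1] and [s2] leaves both [t1] and [t2]. *)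
Lemma voronoi_cell22 (R : realType) (n : nat) (s1 s2 t1 t2 x : 'rV[R]_n) :
  let q y := \sum_(i < n) (x - y) 0 i ^+ 2 in
  s1 != t1 -> s1 != t2 -> s2 != t1 -> s2 != t2 ->
  voronoi_cell [fset s1; s2; t1; t2]%fset [fset s1; s2]%fset x <->
  [/\ q s1 <= q t1, q s1 <= q t2, q s2 <= q t2 & q s2 <= q t1].
Proof.
move=> q n11 n12 n21 n22; rewrite voronoi_cellE; split=> [H|[h11 h12 h22 h21] s t].
  by split; apply: H; rewrite !inE ?eqxx ?orbT// negb_or ?[t1 == _]eq_sym
    ?[t2 == _]eq_sym ?n11 ?n12 ?n21 ?n22.
rewrite !inE negb_or => sE tE /andP[/negbTE ts1 /negbTE ts2].
by move: tE; rewrite ts1 ts2 /=; case/orP: sE => /eqP -> /orP[]/eqP ->.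
Qed.

Lemma cardfs4 (K : choiceType) (x1 x2 x3 x4 : K) :
  x1 != x2 -> x1 != x3 -> x1 != x4 -> x2 != x3 -> x2 != x4 -> x3 != x4 ->
  #|` [fset x1; x2; x3; x4]%fset| = 4%N.
Proof.
move=> n12 n13 n14 n23 n24 n34.
rewrite fsetUC cardfsU1 fsetUC cardfsU1 cardfs2 !inE !negb_or n12.
by rewrite ![x4 == _]eq_sym ![x3 == x1]eq_sym [x3 == x2]eq_sym n13 n14 n23 n24 n34.
Qed.

(** * From four extreme points to a pair of crossing diagonals *)

Lemma sqnorm2_gt0 (R : realType) (u : 'rV[R]_2) : u != 0 -> 0 < sqnorm2 u.
Proof.
move=> u0; rewrite lt_neqAle addr_ge0 ?sqr_ge0// andbT eq_sym.
apply: contra u0; rewrite paddr_eq0 ?sqr_ge0// !sqrf_eq0 => /andP[/eqP h0 /eqP h1].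
by apply/eqP; apply: row2P; rewrite mxE.
Qed.

Lemma cross_eq0_colinear (R : realType) (u v : 'rV[R]_2) :
  u != 0 -> cross u v = 0 -> exists t, v = t *: u.
Proof.
move=> /sqnorm2_gt0; rewrite /cross /sqnorm2 => u0 D0.
have n0 : u 0 0 ^+ 2 + u 0 1 ^+ 2 != 0 by rewrite gt_eqF.
(* The coefficient of the orthogonal projection of [v] on [u]; the remaining component of [v] is a
   multiple of [cross u v]. *)
exists ((u 0 0 * v 0 0 + u 0 1 * v 0 1) / (u 0 0 ^+ 2 + u 0 1 ^+ 2)).
apply: row2P; rewrite !mxE; apply: (mulfI n0).
  rewrite (_ : (_ + _) * v 0 0 = (u 0 0 * v 0 0 + u 0 1 * v 0 1) * u 0 0
     - u 0 1 * (u 0 0 * v 0 1 - u 0 1 * v 0 0)); last by ring.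
  by rewrite D0; field.
rewrite (_ : (_ + _) * v 0 1 = (u 0 0 * v 0 0 + u 0 1 * v 0 1) * u 0 1
     + u 0 0 * (u 0 0 * v 0 1 - u 0 1 * v 0 0)); last by ring.
by rewrite D0; field.
Qed.

Lemma extreme_points_cross_neq0 (R : realType) (F : set 'rV[R]_2)
    (x y z : 'rV[R]_2) :
  extreme_points F x -> extreme_points F y -> extreme_points F z ->
  x != y -> x != z -> y != z -> cross (y - x) (z - x) != 0.
Proof.
move=> ex ey ez /eqP nxy /eqP nxz /eqP nyz; apply/eqP => /cross_eq0_colinear.
rewrite subr_eq0 eq_sym => -[|t /eqP]; first exact/eqP.
rewrite subr_eq addrC => /eqP zE.
(* Since [z = x + t (y - x)], the range of [t] decides which point lies between the other two: [x]
   for [t <= 0], [z] for [0 < t <= 1], [y] for [t > 1]. This contradicts its extremality. *)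
have [t0|t0] := leP t 0.
  have tn0 : 1 - t != 0 by rewrite gt_eqF//; lra.
  have l : 0 <= (1 - t)^-1 by rewrite invr_ge0; lra.
  have r : (1 - t)^-1 <= 1 by rewrite invf_le1; lra.
  case: (@extreme_point_conv _ _ F x z y (1 - t)^-1) => //; try by case: ez ey.
    by case: ey.
  by apply/rowP => i; rewrite zE !mxE; field.
have [t1|t1] := leP t 1.
  case: (@extreme_point_conv _ _ F z y x t) => //; try exact: ltW.
  - by case: ey.
  - by case: ex.
  - by apply/rowP => i; rewrite zE !mxE; ring.
  - exact/nesym.
  - exact/nesym.
have tn0 : t != 0 by rewrite gt_eqF.
have l : 0 <= t^-1 by rewrite invr_ge0 ltW.
have r : t^-1 <= 1 by rewrite invf_le1// ltW.
case: (@extreme_point_conv _ _ F y z x t^-1) => //.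
- by case: ez.
- by case: ex.
- by apply/rowP => i; rewrite zE !mxE; field.
- exact/nesym.
Qed.

(** Divided by the common total weight, both sides of the dependence are the same point [P] of the
    segments [a c] and [b d], namely the crossing of the diagonals. The ratios of the weights are
    the ratios in which [P] divides them. *)
Lemma diag_verticesP (R : realType) (a b c d : 'rV[R]_2) (wa wb wc wd : R) :
  0 < wa -> 0 < wb -> 0 < wc -> 0 < wd -> wa + wc = wb + wd ->
  wa *: a + wc *: c = wb *: b + wd *: d -> cross (b - a) (c - a) != 0 ->
  exists P u v r s, [/\ 0 < r, 0 < s, cross u v != 0 &
    [set a; c] `|` [set b; d] = diag_vertices P u v r s].
Proof.
move=> wa0 wb0 wc0 wd0 ws wE D0.
have wn0 : wa + wc != 0 by rewrite gt_eqF//; lra.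
have wan0 : wa != 0 by rewrite gt_eqF.
have wcn0 : wc != 0 by rewrite gt_eqF.
have wdn0 : wd != 0 by rewrite gt_eqF.
pose P := (wa + wc)^-1 *: (wa *: a + wc *: c).
exists P, (a - P), (b - P), (wa / wc), (wb / wd); split.
- exact: divr_gt0.
- exact: divr_gt0.
- apply: contra D0 => /eqP D0; apply/eqP.
  rewrite (_ : cross _ _ = (wa + wc) / wc * cross (a - P) (b - P)).
    by rewrite D0 mulr0.
  by rewrite /cross /P !mxE; field; rewrite ?wn0.
- rewrite /diag_vertices [P + (a - P)]addrC subrK [P + (b - P)]addrC subrK.
  congr ([set _; _] `|` [set _; _]).
    by apply/rowP => i; rewrite !mxE; field; rewrite ?wn0.
  rewrite /P wE ws in wn0 *.
  by apply/rowP => i; rewrite !mxE; field; rewrite ?wn0.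
Qed.

(* Cramer's rule gives an affine dependence w between the four points.  A sign
   pattern 1 + 3 would put one point in the hull of the others, so two
   coefficients are positive and two negative. *)
Lemma quadrilateral_diag (R : realType) (F : set 'rV[R]_2)
    (x1 x2 x3 x4 : 'rV[R]_2) :
  convex_set F ->
  extreme_points F x1 -> extreme_points F x2 ->
  extreme_points F x3 -> extreme_points F x4 ->
  x1 != x2 -> x1 != x3 -> x1 != x4 -> x2 != x3 -> x2 != x4 -> x3 != x4 ->
  exists P u v r s, [/\ 0 < r, 0 < s, cross u v != 0 &
    [set x1; x2] `|` [set x3; x4] = diag_vertices P u v r s].
Proof.
move=> cF e1 e2 e3 e4 n12 n13 n14 n23 n24 n34.
have Fe y : extreme_points F y -> F y by case.
have notin3 p y z t (a b c : R) : extreme_points F p -> extreme_points F y ->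
    extreme_points F z -> extreme_points F t ->
    p != y -> p != z -> p != t -> 0 < a -> 0 < b -> 0 < c ->
    (a + b + c) *: p <> a *: y + b *: z + c *: t.
  move=> ep ey ez et /eqP py /eqP pz /eqP pt a0 b0 c0.
  move/(extreme_point_comb3 cF ep (Fe _ ey) (Fe _ ez) (Fe _ et)
    (ltW a0) (ltW b0) (ltW c0)).
  by rewrite !addr_gt0// => /(_ isT) [].
have D234 := extreme_points_cross_neq0 e2 e3 e4 n23 n24 n34.
have D134 := extreme_points_cross_neq0 e1 e3 e4 n13 n14 n34.
have D124 := extreme_points_cross_neq0 e1 e2 e4 n12 n14 n24.
have D123 := extreme_points_cross_neq0 e1 e2 e3 n12 n13 n23.
have D132 : cross (x3 - x1) (x2 - x1) != 0.
  by rewrite (_ : cross _ _ = - cross (x2 - x1) (x3 - x1)) ?oppr_eq0// /cross; ring.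
have eq_of_sub0 (y z : 'rV[R]_2) : y - z = 0 -> y = z.
  by move/eqP; rewrite subr_eq0 => /eqP.
(* Negating the dependence if necessary makes [w1] positive. In a 2 + 2 pattern, points whose
   coefficients have equal sign are opposite vertices. *)
have pos (w1 w2 w3 w4 : R) : 0 < w1 -> w2 != 0 -> w3 != 0 -> w4 != 0 ->
    w1 + w2 + w3 + w4 = 0 -> w1 *: x1 + w2 *: x2 + w3 *: x3 + w4 *: x4 = 0 ->
    exists P u v r s, [/\ 0 < r, 0 < s, cross u v != 0 &
      [set x1; x2] `|` [set x3; x4] = diag_vertices P u v r s].
  move=> w1p w2n0 w3n0 w4n0 ws wE.
  have [w2p|w2p|w20] := ltgtP 0 w2; last by rewrite -w20 eqxx in w2n0.
    have [w3p|w3p|w30] := ltgtP 0 w3; last by rewrite -w30 eqxx in w3n0.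
      case: (notin3 x4 x1 x2 x3 w1 w2 w3) => //; try by rewrite eq_sym.
      apply: eq_of_sub0; rewrite -[RHS]oppr0 -wE (_ : w1 + w2 + w3 = - w4); last lra.
      by apply/rowP => i; rewrite !mxE; ring.
    have [w4p|w4p|w40] := ltgtP 0 w4; last by rewrite -w40 eqxx in w4n0.
      case: (notin3 x3 x1 x2 x4 w1 w2 w4) => //; try by rewrite eq_sym.
      apply: eq_of_sub0; rewrite -[RHS]oppr0 -wE (_ : w1 + w2 + w4 = - w3); last lra.
      by apply/rowP => i; rewrite !mxE; ring.
    apply: (@diag_verticesP _ x1 x3 x2 x4 w1 (- w3) w2 (- w4)); rewrite ?oppr_gt0//; first lra.
    by apply: eq_of_sub0; rewrite -wE; apply/rowP => i; rewrite !mxE; ring.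
  have [w3p|w3p|w30] := ltgtP 0 w3; last by rewrite -w30 eqxx in w3n0.
    have [w4p|w4p|w40] := ltgtP 0 w4; last by rewrite -w40 eqxx in w4n0.
      case: (notin3 x2 x1 x3 x4 w1 w3 w4) => //; try by rewrite eq_sym.
      apply: eq_of_sub0; rewrite -[RHS]oppr0 -wE (_ : w1 + w3 + w4 = - w2); last lra.
      by apply/rowP => i; rewrite !mxE; ring.
    rewrite (_ : _ `|` _ = [set x1; x3] `|` [set x2; x4]); last exact: setUACA.
    apply: (@diag_verticesP _ x1 x2 x3 x4 w1 (- w2) w3 (- w4)); rewrite ?oppr_gt0//; first lra.
    by apply: eq_of_sub0; rewrite -wE; apply/rowP => i; rewrite !mxE; ring.
  have [w4p|w4p|w40] := ltgtP 0 w4; last by rewrite -w40 eqxx in w4n0.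
    rewrite (_ : _ `|` _ = [set x1; x4] `|` [set x2; x3]); last first.
      by rewrite [[set x3; _]]setUC setUACA.
    apply: (@diag_verticesP _ x1 x2 x4 x3 w1 (- w2) w4 (- w3)); rewrite ?oppr_gt0//; first lra.
    by apply: eq_of_sub0; rewrite -wE; apply/rowP => i; rewrite !mxE; ring.
  case: (notin3 x1 x2 x3 x4 (- w2) (- w3) (- w4)) => //; try by rewrite oppr_gt0.
  apply: eq_of_sub0; rewrite -wE (_ : _ + - w4 = w1); last lra.
  by apply/rowP => i; rewrite !mxE; ring.
(* Each coefficient is, up to sign, twice the area of the triangle on the other three points, so it
   is nonzero because no three of the points are collinear. *)
pose w1 := cross (x3 - x2) (x4 - x2).
pose w2 := - cross (x3 - x1) (x4 - x1).
pose w3 := cross (x2 - x1) (x4 - x1).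
pose w4 := - cross (x2 - x1) (x3 - x1).
have ws : w1 + w2 + w3 + w4 = 0.
  by rewrite /w1 /w2 /w3 /w4 /cross !mxE; ring.
have wE : w1 *: x1 + w2 *: x2 + w3 *: x3 + w4 *: x4 = 0.
  by rewrite /w1 /w2 /w3 /w4 /cross; apply: row2P; rewrite !mxE; ring.
have w2n0 : w2 != 0 by rewrite oppr_eq0.
have w4n0 : w4 != 0 by rewrite oppr_eq0.
have [w1p|w1p|/eqP] := ltgtP 0 w1; last by rewrite eq_sym (negPf D234).
  exact: (pos w1 w2 w3 w4).
apply: (pos (- w1) (- w2) (- w3) (- w4)); rewrite ?oppr_eq0 ?oppr_gt0//.
  lra.
by rewrite -oppr0 -wE !scaleNr !opprD.
Qed.

(** * The Voronoi realisation and the cyclic case *)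

Lemma diag_quad_voronoi (R : realType) (P u v : 'rV[R]_2) (c d : R) :
  0 < c -> 0 < d -> cross u v != 0 -> c * sqnorm2 u < d * sqnorm2 v ->
  exists S T : {fset 'rV[R]_2},
    [/\ (S `<=` T)%fset, #|` S| = 2%N, #|` T| = 4%N &
        voronoi_cell T S = diag_quad P u v c d].
Proof.
move=> c0 d0 D0 lt.
have N0 : 0 < d * sqnorm2 v - c * sqnorm2 u by rewrite subr_gt0.
have [s1 [s2 [t1 [t2 edges]]]] := @sqdist_edges R P u v c d (lt0r_neq0 N0).
set k := (4 * _ / _) in edges.
have k0 : 0 < k by rewrite divr_gt0// mulr_gt0// exprn_even_gt0.
have kc0 : 0 < k * c by exact: mulr_gt0.
have kd0 : 0 < k * d by exact: mulr_gt0.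
have kcd0 : 0 < k * (c * d) by rewrite mulrA mulr_gt0.
(* At the crossing point [P] all four differences are positive. *)
have [n11 n12 n22 n21] : [/\ s1 != t1, s1 != t2, s2 != t2 & s2 != t1].
  have [/= e11 e12 e22 e21] := edges 0 0.
  by split; apply/eqP => E; [move: e11|move: e12|move: e22|move: e21];
    rewrite E subrr => /esym/eqP; rewrite gt_eqF//; nra.
(* At the vertex [P + v] the site [t1] is as far as [s1] but strictly farther than [s2]; at [P + u],
   similarly, [t1] is as far as [s1] while [t2] is strictly farther. *)
have ns : s1 != s2.
  apply/eqP => E; have [/= e11 _ _ e21] := edges 0 1.
  by move: e11 e21; rewrite E => ->; nra.
have nt : t1 != t2.
  apply/eqP => E; have [/= e11 e12 _ _] := edges 1 0.
  by move: e11 e12; rewrite E => ->; nra.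
exists [fset s1; s2]%fset, [fset s1; s2; t1; t2]%fset; split.
- by apply/fsubsetP => x; rewrite !inE => /orP[]->; rewrite ?orbT.
- by rewrite cardfs2 ns.
- exact: cardfs4.
apply/seteqP; split=> x.
  move=> /(voronoi_cell22 _ n11 n12 n21 n22).
  rewrite (cross_coord P x D0); set xi := _ / _; set eta := _ / _.
  have [/= e11 e12 e22 e21] := edges xi eta => -[h11 h12 h22 h21].
  exists xi, eta; split=> //; split.
  - by rewrite -subr_ge0 opprD addrA -(pmulr_rge0 _ kcd0) -e11 subr_ge0.
  - by rewrite -subr_ge0 -(pmulr_rge0 _ kd0) -e12 subr_ge0.
  - by rewrite -subr_ge0 -(pmulr_rge0 _ kc0) -e21 subr_ge0.
  - by rewrite -(pmulr_rge0 _ k0) -e22 subr_ge0.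
move=> [xi [eta [-> [h1 h2 h3 h4]]]].
apply/(voronoi_cell22 _ n11 n12 n21 n22).
have [/= e11 e12 e22 e21] := edges xi eta.
split; rewrite -subr_ge0.
- by rewrite e11 pmulr_rge0//; lra.
- by rewrite e12 pmulr_rge0//; lra.
- by rewrite e22 pmulr_rge0.
- by rewrite e21 pmulr_rge0//; lra.
Qed.

(** Converse of the intersecting chords theorem. The centre [P + w] projects onto the midpoints of
    both diagonals: [w] has inner products [(1 - c) |u|^2 / 2] with [u] and [(1 - d) |v|^2 / 2] with
    [v]. The squared radius is [|w|^2] plus the common product of the chord segments. *)
Lemma diag_vertices_concyclic (R : realType) (P u v : 'rV[R]_2) (c d : R) :
  0 < c -> cross u v != 0 -> c * sqnorm2 u = d * sqnorm2 v ->
  exists ctr r, 0 < r /\ diag_vertices P u v c d `<=` circle ctr r.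
Proof.
move=> c0 D0 cyc.
pose a := (1 - c) * sqnorm2 u / 2 / cross u v.
pose b := (1 - d) * sqnorm2 v / 2 / cross u v.
pose w : 'rV[R]_2 := \row_i if i == 0 then a * v 0 1 - b * u 0 1
  else b * u 0 0 - a * v 0 0.
have u0 : 0 < sqnorm2 u.
  apply: sqnorm2_gt0; apply: contra D0 => /eqP ->.
  by rewrite /cross !mxE !mul0r subrr.
exists (P + w), (Num.sqrt (sqnorm2 w + c * sqnorm2 u)); split.
  by rewrite sqrtr_gt0 ltr_wpDl ?mulr_gt0// addr_ge0 ?sqr_ge0.
move=> x; rewrite /circle /euclidean_norm /= sqdist2E => Hx.
congr Num.sqrt; move: Hx => [|]; last rewrite cyc; move=> [] ->;
  by rewrite !mxE /= /sqnorm2 !mxE /= /a /b /sqnorm2 /cross in D0 *; field.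
Qed.

Theorem proposition3p4 (R : realType) (F : set 'rV[R]_2) :
  convex_quadrilateral F -> ~ cyclic_polygon F ->
  exists S T : {fset 'rV[R]_2},
    [/\ (S `<=` T)%fset, #|` S| = 2%N, #|` T| = 4%N & voronoi_cell T S = F].
Proof.
move=> [A [A4 FE Aex]] ncyc.
have cF : convex_set F by rewrite FE; exact: convex_hull_convex.
have [P [u [v [c [d [c0 d0 D0 AE]]]]]] : exists P u v c d,
    [/\ 0 < c, 0 < d, cross u v != 0 & [set` A] = diag_vertices P u v c d].
  (* The duplicate-free enumeration of [A] yields four distinct points in arbitrary order;
     [quadrilateral_diag] finds out which are opposite. *)
  have AE : [set` A] = [set` enum_fset A] by [].
  have : size (enum_fset A) = 4%N by exact: A4.
  have := fset_uniq A; rewrite AE in Aex *; move: (enum_fset A) Aex => s.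
  case: s => [|x1[|x2[|x3[|x4[|//]]]]]// ex + _.
  rewrite /= !inE !negb_or => /and4P[/and3P[n12 n13 n14] /andP[n23 n24] n34 _].
  rewrite (_ : [set` _] = [set x1; x2] `|` [set x3; x4]).
    by apply: (quadrilateral_diag cF) => //; apply: ex; rewrite /= !inE eqxx ?orbT.
  apply/seteqP; split=> x /=; rewrite !inE.
    by move=> /or4P[] /eqP ->; [left; left|left; right|right; left|right; right].
  by move=> [[]|[]] ->; rewrite eqxx ?orbT.
rewrite FE AE in ncyc *.
have [lt|lt|eq] := ltgtP (c * sqnorm2 u) (d * sqnorm2 v).
- by rewrite convex_hull_diag//; exact: diag_quad_voronoi.
- rewrite diag_verticesC convex_hull_diag//; apply: diag_quad_voronoi => //.
  by rewrite (_ : cross v u = - cross u v) ?oppr_eq0// /cross; ring.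
(* The circle passes through the four generating points, and every extreme point of the hull is one
   of them. *)
- case: ncyc; have [ctr [r [r0 cyc]]] := diag_vertices_concyclic P c0 D0 eq.
  exists ctr, r; split=> //; apply: subset_trans cyc.
  exact: extreme_points_hull.
Qed.
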